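(* Let $n \geq 4$ be an integer, let $m = \lfloor n/4 \rfloor$ and $\bar r = n \bmod 4$. Then the mixed domination number of the generalized Petersen graph $P(n,2)$ is $$\gamma_{md}(P(n,2)) = \begin{cases} 3m & \text{if } \bar r = 0,\\ 3m+1 & \text{if } \bar r = 1,\\ 3m+2 & \text{if } \bar r = 2,\\ 3m+3 & \text{if } \bar r = 3.\end{cases}$$
   Context: For integers $n$ and $k$ with $1 \le k \le n/2$, the generalized Petersen graph $P(n,k)$ has vertex set $\{v_i, u_i : 0 \le i \le n-1\}$ and edge set $\{v_i v_{(i+1) \bmod n},\ v_i u_i,\ u_i u_{(i+k) \bmod n} : 0 \le i \le n-1\}$. For a graph $G=(V,E)$, a set $S \subseteq V \cup E$ is a mixed dominating set if every element of $(V \cup E)\setminus S$ is adjacent or incident to some element of $S$ (vertices are adjacent if joined by an edge, edges are adjacent if they share an endpoint, and a vertex and an edge are incident if the vertex is an endpoint of the edge). The mixed domination number $\gamma_{md}(G)$ is the minimum size of a mixed dominating set of $G$. *)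

(* Defs.v *)
From mathcomp Require Import all_boot.

Set Implicit Arguments.
Unset Strict Implicit.
Unset Printing Implicit Defensive.

(* A graph on the finite vertex type T is given by its edge set
   E : {set {set T}}; it is simple when every edge has exactly two endpoints. *)
Definition simple_graph (T : finType) (E : {set {set T}}) : bool :=
  [forall e in E, #|e| == 2].

Section MixedDomination.

Variables (T : finType) (E : {set {set T}}).

(* The disjoint union V + E lives in T + {set T}; the right summand also
   contains sets that are not edges, hence the restriction to graph_elts. *)
Definition graph_elts : {set T + {set T}} :=
  [set x | if x is inr e then e \in E else true].

Definition mixed_adj (x y : T + {set T}) : bool :=
  match x, y with
  | inl u, inl v => [set u; v] \in E
  | inl u, inr e | inr e, inl u => u \in e
  | inr e, inr f => (e != f) && (e :&: f != set0)
  end.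

Definition mixed_dominating (S : {set T + {set T}}) : bool :=
  (S \subset graph_elts) &&
  [forall x in graph_elts :\: S, exists y in S, mixed_adj x y].

(* graph_elts is only the witness that a mixed dominating set exists. *)
Definition gamma_md : nat :=
  #|[arg min_(S < graph_elts | mixed_dominating S) #|S|]|.

Lemma mixed_dominating_elts : mixed_dominating graph_elts.
Proof.
rewrite /mixed_dominating subxx setDv.
by apply/forall_inP => x; rewrite inE.
Qed.

Lemma gamma_mdP :
  (exists2 S, mixed_dominating S & #|S| = gamma_md) /\
  (forall S, mixed_dominating S -> gamma_md <= #|S|).
Proof.
rewrite /gamma_md; case: arg_minnP => [|S dS minS].
  exact: mixed_dominating_elts.
by split=> //; exists S.
Qed.

End MixedDomination.

Section Petersen.

Variable n : nat.

Lemma ord_addmod_subproof (i : 'I_n) (k : nat) : (i + k) %% n < n.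
Proof. by rewrite ltn_pmod //; apply: leq_ltn_trans (ltn_ord i). Qed.

Definition ord_addmod (i : 'I_n) (k : nat) : 'I_n :=
  Ordinal (ord_addmod_subproof i k).

Definition petersen_vertex : finType := ('I_n + 'I_n)%type.

Definition pv (i : 'I_n) : petersen_vertex := inl i.
Definition pu (i : 'I_n) : petersen_vertex := inr i.

(* Edges form a set, so when n = 2 * k the inner edges
   u_i u_(i+k) and u_(i+k) u_(i+2k) are one and the same. *)
Definition petersen (k : nat) : {set {set petersen_vertex}} :=
  [set [set pv i; pv (ord_addmod i 1)] | i : 'I_n] :|:
  [set [set pv i; pu i] | i : 'I_n] :|:
  [set [set pu i; pu (ord_addmod i k)] | i : 'I_n].

Lemma ord_addmod_neq (i : 'I_n) k : 0 < k -> k < n -> i != ord_addmod i k.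
Proof.
move=> k0 kn; apply/eqP => /(congr1 val) /= Hi.
have : i + 0 == i + k %[mod n] by rewrite addn0 -Hi modn_small.
by rewrite eqn_modDl mod0n modn_small // eq_sym eqn0Ngt k0.
Qed.

Lemma petersen_simple k : 1 <= k -> k.*2 <= n -> simple_graph (petersen k).
Proof.
move=> k1 k2n.
have kn : k < n by apply: leq_trans k2n; rewrite -addnn -addn1 leq_add2l.
apply/forall_inP => e /setUP[/setUP[]|] /imsetP[i _ ->]; rewrite cards2 //.
  by rewrite (inj_eq inl_inj) ord_addmod_neq // (leq_ltn_trans k1).
by rewrite (inj_eq inr_inj) ord_addmod_neq.
Qed.

End Petersen.

(* Main.v *)
Require Import Defs.
From mathcomp Require Import all_boot.
From mathcomp Require Import zify.

(* The value is n - n/4, the ceiling of 3n/4.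

   Lower bound. Let S be mixed dominating, and mark each vertex Dom (in S), Cov
   (on an edge of S but not in S) or Free (the rest), with weights 2, 1, 0. The
   total weight is at most 2 #|S|, no two Free vertices are adjacent, and each
   Free vertex has a Dom neighbor. These conditions only involve nearby
   columns {v_i, u_i}, and a potential on the states of consecutive columns
   shows that around the cycle the columns have average weight at least 3/2.

   Upper bound. For i < 4 (n / 4), column i contributes the edge u_i u_(i+2),
   the vertex v_i, nothing, or the spoke v_i u_i according to i mod 4, and the
   remaining columns contribute their spokes. *)

Set Implicit Arguments.
Unset Strict Implicit.
Unset Printing Implicit Defensive.

Lemma set2_eq (T : finType) (x y a b : T) :
  [set x; y] = [set a; b] -> x = a /\ y = b \/ x = b /\ y = a.
Proof.
move=> eqS.
have /set2P[xE|xE] : x \in [set a; b] by rewrite -eqS set21.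
  have /set2P[yE|yE] : y \in [set a; b] by rewrite -eqS set22.
    have : b \in [set x; y] by rewrite eqS set22.
    by rewrite xE yE setUid inE => /eqP ->; left.
  by left.
have /set2P[yE|yE] : y \in [set a; b] by rewrite -eqS set22.
  by right.
have : a \in [set x; y] by rewrite eqS set21.
by rewrite xE yE setUid inE => /eqP ->; left.
Qed.

(** * Vertex marks and their link with mixed domination *)

Inductive mark := Dom | Cov | Free.

Definition weight (x : mark) : nat :=
  match x with Dom => 2 | Cov => 1 | Free => 0 end.

Definition is_dom (x : mark) : bool := if x is Dom then true else false.

Definition is_free (x : mark) : bool := if x is Free then true else false.

Section Marks.

Variables (T : finType) (E : {set {set T}}).
Implicit Type S : {set T + {set T}}.

Definition mark_of S (x : T) : mark :=
  if inl x \in S then Dom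
  else if [exists e, (inr e \in S) && (x \in e)] then Cov else Free.

Lemma mark_of_dom S x : is_dom (mark_of S x) = (inl x \in S).
Proof. by rewrite /mark_of; case: ifP => // _; case: ifP. Qed.

Lemma mark_of_vertex S x : inl x \in S -> ~~ is_free (mark_of S x).
Proof. by rewrite /mark_of => ->. Qed.

Lemma mark_of_edge S e x : inr e \in S -> x \in e -> ~~ is_free (mark_of S x).
Proof.
rewrite /mark_of => eS xe; case: ifP => // _.
by rewrite (_ : [exists e, _] = true) //; apply/existsP; exists e; rewrite eS.
Qed.

Lemma mark_of_not_free S x :
  ~~ is_free (mark_of S x) ->
  inl x \in S \/ exists2 e, inr e \in S & x \in e.
Proof.
rewrite /mark_of; case: ifP => [|_]; first by left.
by case: existsP => // -[e /andP[eS xe]] _; right; exists e.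
Qed.

Hypothesis simpE : simple_graph E.

(** Whether [e] is dominated by itself, by an endpoint or by an edge sharing an endpoint with it,
    the dominating element leaves some vertex of [e] marked [Dom] or [Cov]. *)
Lemma mixed_dominating_edge S e :
  mixed_dominating E S -> e \in E ->
  exists2 x, x \in e & ~~ is_free (mark_of S x).
Proof.
move=> /andP[_ /forall_inP domS] eE.
have [eS|neS] := boolP (inr e \in S).
  have /card_gt0P[x xe] : 0 < #|e| by rewrite (eqP (forall_inP simpE e eE)).
  by exists x => //; apply: mark_of_edge xe.
have /exists_inP[[x|f] xS /=] : [exists y in S, mixed_adj E (inr e) y].
- by apply: domS; rewrite !inE neS eE.
- by move=> xe; exists x => //; apply: mark_of_vertex.
case/andP=> _ /set0Pn[x /setIP[xe xf]].
by exists x => //; apply: mark_of_edge xf.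
Qed.

(** An incident edge of [S] would make [x] covered, so only a vertex of [S] can dominate it. *)
Lemma mixed_dominating_vertex S x :
  mixed_dominating E S -> is_free (mark_of S x) ->
  exists2 y, is_dom (mark_of S y) & [set x; y] \in E.
Proof.
move=> /andP[_ /forall_inP domS] frx.
have nxS : inl x \notin S by apply: contraL frx => /mark_of_vertex.
have /exists_inP[[y|f] yS /=] : [exists y in S, mixed_adj E (inl x) y].
- by apply: domS; rewrite !inE nxS.
- by move=> xyE; exists y => //; rewrite mark_of_dom.
by move=> xf; have := mark_of_edge yS xf; rewrite frx.
Qed.

(** Double counting: a vertex of [S] sends 2 to itself, an edge of [S] sends 1 to each of its two
    endpoints, and every [x] receives at least its weight. *)
Lemma sum_weight_mark S :
  S \subset graph_elts E -> \sum_x weight (mark_of S x) <= #|S|.*2.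
Proof.
move=> subS.
pose c (s : T + {set T}) (x : T) : nat :=
  match s with inl y => (x == y).*2 | inr e => x \in e end.
apply: (@leq_trans (\sum_x \sum_(s in S) c s x)).
  apply: leq_sum => x _; rewrite /mark_of; case: ifP => [xS|_].
    by rewrite (bigD1 (inl x)) //= eqxx leq_addr.
  case: existsP => [[e /andP[eS xe]]|//].
  by rewrite (bigD1 (inr e)) //= xe leq_addr.
rewrite exchange_big /= -muln2 -sum_nat_const; apply: leq_sum => -[y|e] sS /=.
  rewrite (bigD1 y) //= eqxx big1 // => x /negbTE -> //.
have eE : e \in E by have := subsetP subS _ sS; rewrite inE.
by rewrite -big_mkcond /= sum1_card (eqP (forall_inP simpE e eE)).
Qed.

Lemma mixed_dominatingI S :
  S \subset graph_elts E ->
  (forall e, e \in E -> exists2 x, x \in e & ~~ is_free (mark_of S x)) ->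
  (forall x, is_free (mark_of S x) ->
     exists2 y, is_dom (mark_of S y) & [set x; y] \in E) ->
  mixed_dominating E S.
Proof.
move=> subS covE domV; apply/andP; split=> //.
apply/forall_inP => -[x|e]; rewrite !inE => /andP[nS].
  move=> _; apply/exists_inP.
  have [/domV[y]|/mark_of_not_free[xS|[e eS xe]]] := boolP (is_free (mark_of S x)).
  - by rewrite mark_of_dom => yS xyE; exists (inl y).
  - by rewrite xS in nS.
  by exists (inr e).
move=> /covE[x xe /mark_of_not_free[xS|[f fS xf]]]; apply/exists_inP.
  by exists (inl x).
exists (inr f) => //=; apply/andP; split.
  by apply: contraNneq nS => ->.
by apply/set0Pn; exists x; rewrite inE xe.
Qed.

End Marks.

(** * Potential argument on cyclic sequences of columns *)

(* A Free vertex is PSat or PPend according to whether a Dom neighbor has already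
   been met when the columns are read from left to right. *)
Inductive phase := PDom | PCov | PSat | PPend.

Definition phase_of (x : mark) (d : bool) : phase :=
  match x with
  | Dom => PDom
  | Cov => PCov
  | Free => if d then PSat else PPend
  end.

(* The state (p, q, r) holds the phases of v_i, u_i, u_(i-1). The table lists the
   largest amount by which twice the weight of a walk leaving that state can fall
   short of 3 per column; the states omitted have v_i and u_i both free. *)
Definition potential (p q r : phase) : nat :=
  let row a b c d := match r with PDom => a | PCov => b | PSat => c | PPend => d end in
  match p, q with
  | PDom, PDom => row 4 4 4 2
  | PDom, PCov => row 3 3 3 2
  | PDom, PSat => row 2 2 2 1
  | PDom, PPend => row 2 1 1 0
  | PCov, PDom => row 3 3 2 2
  | PCov, PCov => row 3 2 2 2
  | PCov, PSat => row 2 2 1 1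
  | PCov, PPend => row 2 1 1 0
  | PSat, PDom => row 3 3 2 0
  | PSat, PCov => row 3 2 1 0
  | PPend, PDom | PPend, PCov => row 1 1 0 0
  | _, _ => 0
  end.

(** Here [x], [y] mark column i, [a], [b] mark column i+1, and [z] marks u_(i-1). The new column
    brings the last neighbors of v_i and u_(i-1), so either of them that is free must have met a
    [Dom] neighbor by now; u_i still awaits u_(i+2), so its flag [dy] is carried over. *)
Lemma potential_step (x y z a b : mark) (dx dy dz : bool) :
  ~~ (is_free x && is_free y) -> ~~ (is_free a && is_free b) ->
  ~~ (is_free x && is_free a) -> ~~ (is_free z && is_free b) ->
  (is_free x -> dx || is_dom a) -> (is_free z -> dz || is_dom b) ->
  3 + potential (phase_of a (is_dom x || is_dom b))
        (phase_of b (is_dom z || is_dom a)) (phase_of y dy)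
    <= 2 * (weight a + weight b)
       + potential (phase_of x dx) (phase_of y dy) (phase_of z dz).
Proof.
case: x => //=; case: a => //=; case: z => //=; case: b => //=; case: y => //=;
  case: dx => //=; case: dz => //=; case: dy => //= *; lia.
Qed.

Lemma sum_periodic_shift (F : nat -> nat) n k :
  (forall i, F (i + n) = F i) -> \sum_(i < n) F (i + k) = \sum_(i < n) F i.
Proof.
move=> perF; elim: k => [|k <-].
  by apply: eq_bigr => i _; rewrite addn0.
case: n perF => [|n] perF; first by rewrite !big_ord0.
rewrite big_ord_recr big_ord_recl /= addnC; congr (_ + _).
  by rewrite -(perF (0 + k)); congr F; lia.
by apply: eq_bigr => i _; congr F; rewrite /= /bump /=; lia.
Qed.

Lemma sum_weight_cyclic (v u : nat -> mark) n :
  (forall i, v (i + n) = v i) -> (forall i, u (i + n) = u i) ->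
  (forall i, ~~ (is_free (v i) && is_free (v i.+1))) ->
  (forall i, ~~ (is_free (v i) && is_free (u i))) ->
  (forall i, ~~ (is_free (u i) && is_free (u i.+2))) ->
  (forall i, is_free (v i.+1) ->
     [|| is_dom (v i), is_dom (v i.+2) | is_dom (u i.+1)]) ->
  (forall i, is_free (u i.+2) ->
     [|| is_dom (u i), is_dom (u i.+4) | is_dom (v i.+2)]) ->
  3 * n <= 2 * \sum_(i < n) (weight (v i) + weight (u i)).
Proof.
move=> perv peru freevv freevu freeuu domv domu.
(* This is the state at column [i.+3]: the earliest vertex consulted is [u i], the left neighbor of
   [u i.+2], so no index is ever subtracted. *)
pose pot i := potential
  (phase_of (v i.+3) (is_dom (v i.+2) || is_dom (u i.+3)))
  (phase_of (u i.+3) (is_dom (u i.+1) || is_dom (v i.+3)))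
  (phase_of (u i.+2) (is_dom (u i) || is_dom (v i.+2))).
pose c i := weight (v i) + weight (u i).
have step i : 3 + pot (i + 1) <= 2 * c (i + 4) + pot i.
  rewrite addn1 addn4; apply: potential_step => //.
    by move/domv/or3P=> [] ->; rewrite ?orbT.
  by move/domu/or3P=> [] ->; rewrite ?orbT.
have perpot i : pot (i + n) = pot i.
  by rewrite /pot -!addSn !perv !peru.
have perc i : c (i + n) = c i by rewrite /c perv peru.
have : \sum_(i < n) (3 + pot (i + 1)) <= \sum_(i < n) (2 * c (i + 4) + pot i).
  by apply: leq_sum => i _; apply: step.
(* By periodicity the shifts disappear from the sums, and the potential cancels. *)
rewrite big_split [X in _ <= X]big_split /=.
rewrite -big_distrr sum_nat_const card_ord mulnC.
by rewrite (sum_periodic_shift _ perpot) (sum_periodic_shift _ perc) leq_add2r.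
Qed.

(** * Edges and neighborhoods in the generalized Petersen graph *)

Section PetersenEdges.

Variables (n k : nat).
Implicit Type i : 'I_n.

Lemma outer_edge i : [set pv i; pv (ord_addmod i 1)] \in petersen n k.
Proof. by apply/setUP; left; apply/setUP; left; apply: imset_f. Qed.

Lemma spoke_edge i : [set pv i; pu i] \in petersen n k.
Proof. by apply/setUP; left; apply/setUP; right; apply: imset_f. Qed.

Lemma inner_edge i : [set pu i; pu (ord_addmod i k)] \in petersen n k.
Proof. by apply/setUP; right; apply: imset_f. Qed.

Lemma petersen_edgeP (e : {set petersen_vertex n}) :
  e \in petersen n k ->
  [\/ exists i, e = [set pv i; pv (ord_addmod i 1)],
      exists i, e = [set pv i; pu i]
    | exists i, e = [set pu i; pu (ord_addmod i k)]].
Proof.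
case/setUP=> [/setUP[]|] /imsetP[i _ ->].
- by apply: Or31; exists i.
- by apply: Or32; exists i.
by apply: Or33; exists i.
Qed.

Lemma pv_neighbor i (y : petersen_vertex n) :
  [set pv i; y] \in petersen n k ->
  [\/ y = pv (ord_addmod i 1), y = pu i
    | exists2 j, y = pv j & i = ord_addmod j 1].
Proof.
case/petersen_edgeP=> -[j /set2_eq[] []] //.
- by case=> -> ->; apply: Or31.
- by case=> -> ->; apply: Or33; exists j.
- by case=> -> ->; apply: Or32.
Qed.

Lemma pu_neighbor i (y : petersen_vertex n) :
  [set pu i; y] \in petersen n k ->
  [\/ y = pu (ord_addmod i k), y = pv i
    | exists2 j, y = pu j & i = ord_addmod j k].
Proof.
case/petersen_edgeP=> -[j /set2_eq[] []] //.
- by case=> -> ->; apply: Or32.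
- by case=> -> ->; apply: Or31.
- by case=> -> ->; apply: Or33; exists j.
Qed.

End PetersenEdges.

(** * Lower bound for P(n,2) *)

Lemma petersen_mixed_dominating_card n S :
  4 <= n -> mixed_dominating (petersen n 2) S -> 3 * n <= 4 * #|S|.
Proof.
move=> n4 domS; have n0 : 0 < n by lia.
have simpP : simple_graph (petersen n 2) by apply: petersen_simple.
(* [o] unrolls the cycle, turning the marks into n-periodic sequences over [nat]. *)
pose o i : 'I_n := Ordinal (ltn_pmod i n0).
have oD i k : ord_addmod (o i) k = o (i + k) by apply: val_inj; rewrite /= modnDml.
have oper i : o (i + n) = o i by apply: val_inj; rewrite /= modnDr.
have opred i j k : o (i + k) = ord_addmod j k -> j = o i.
  move=> /(congr1 val) /= /eqP; rewrite eqn_modDr => /eqP ij.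
  by apply: val_inj; rewrite /= ij modn_small.
have edgeN x y : [set x; y] \in petersen n 2 ->
    ~~ (is_free (mark_of S x) && is_free (mark_of S y)).
  move/(mixed_dominating_edge simpP domS) => [z /set2P[] -> nf];
  by rewrite negb_and nf ?orbT.
pose v i := mark_of S (pv (o i)); pose u i := mark_of S (pu (o i)).
have cyc : 3 * n <= 2 * \sum_(i < n) (weight (v i) + weight (u i)).
  apply: sum_weight_cyclic => i.
  - by rewrite /v oper.
  - by rewrite /u oper.
  - by apply: edgeN; rewrite -addn1 -oD outer_edge.
  - by apply: edgeN; rewrite spoke_edge.
  - by apply: edgeN; rewrite -addn2 -oD inner_edge.
  - case/(mixed_dominating_vertex domS) => y ydom /pv_neighbor[yE|yE|[j yE]].
    + by rewrite /v -[i.+2]addn1 -oD -yE ydom orbT.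
    + by rewrite /u -yE ydom !orbT.
    + by rewrite -addn1 => /opred jE; rewrite /v -jE -yE ydom.
  case/(mixed_dominating_vertex domS) => y ydom /pu_neighbor[yE|yE|[j yE]].
  - by rewrite /u -[i.+4]addn2 -oD -yE ydom orbT.
  - by rewrite /v -yE ydom !orbT.
  - by rewrite -addn2 => /opred jE; rewrite /u -jE -yE ydom.
have oK (i : 'I_n) : o i = i by apply: val_inj; rewrite /= modn_small.
have /andP[subS _] := domS.
have := sum_weight_mark simpP subS; rewrite big_sumType /= -big_split /=.
have <- : \sum_(i < n) (weight (v i) + weight (u i)) =
    \sum_(i < n) (weight (mark_of S (pv i)) + weight (mark_of S (pu i))).
  by apply: eq_bigr => i _; rewrite /v /u !oK.
lia.
Qed.

(** * Upper bound from a pattern of period four *)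

Section UpperBound.

Variable n : nat.
Hypothesis n4 : 4 <= n.
Implicit Type i : 'I_n.

(* On the last n %% 4 columns the value is 3, the slot of a spoke. *)
Definition slot (i : nat) : nat := if i < 4 * (n %/ 4) then i %% 4 else 3.

Definition pattern_elt i : petersen_vertex n + {set petersen_vertex n} :=
  match slot i with
  | 0 => inr [set pu i; pu (ord_addmod i 2)]
  | 1 => inl (pv i)
  | _ => inr [set pv i; pu i]
  end.

Definition pattern := [set pattern_elt i | i : 'I_n & slot i != 2].

Lemma slot_le3 i : slot i <= 3.
Proof. by rewrite /slot; case: ifP => // _; lia. Qed.

(** A slot below 3 lies in a full block of four columns; a move to the right ending at slot 3 or
    earlier stays in that block and never wraps modulo [n]. *)
Lemma slot_addmod i k :
  slot i < 3 -> slot i + k <= 3 -> slot (ord_addmod i k) = slot i + k.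
Proof.
have := ltn_ord i; rewrite /slot /= => lt_in i3 ik.
have ikn : i + k < n by move: ik i3; case: ifP; lia.
by rewrite (modn_small ikn); move: ik i3; case: ifP; case: ifP; lia.
Qed.

Lemma pattern_vertex i : slot i = 1 -> inl (pv i) \in pattern.
Proof.
by move=> si; apply/imsetP; exists i; rewrite ?inE ?/pattern_elt si.
Qed.

Lemma pattern_spoke i : slot i = 3 -> inr [set pv i; pu i] \in pattern.
Proof.
by move=> si; apply/imsetP; exists i; rewrite ?inE ?/pattern_elt si.
Qed.

Lemma pattern_inner i :
  slot i = 0 -> inr [set pu i; pu (ord_addmod i 2)] \in pattern.
Proof.
by move=> si; apply/imsetP; exists i; rewrite ?inE ?/pattern_elt si.
Qed.

Lemma slot_pred i k : k <= slot i -> slot i < 3 ->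
  exists2 j, i = ord_addmod j k & slot j = slot i - k.
Proof.
have := ltn_ord i; rewrite /slot => lt_in ki i3.
have lt_jn : i - k < n by lia.
have le_ki : k <= i by move: ki i3; case: ifP; lia.
exists (Ordinal lt_jn) => /=; last by move: ki i3; case: ifP; case: ifP; lia.
by apply: val_inj; rewrite /= subnK // modn_small.
Qed.

Lemma pattern_pv i : odd (slot i) -> ~~ is_free (mark_of pattern (pv i)).
Proof.
have := slot_le3 i; case si: (slot i) => [|[|[|[|]]]] //= _ _.
  by apply: mark_of_vertex; apply: pattern_vertex.
by apply: mark_of_edge (pattern_spoke si) _; rewrite set21.
Qed.

(** Slots 0 and 2 are the two ends of the inner edge chosen at slot 0, and slot 3 carries a
    spoke. *)
Lemma pattern_pu i : slot i != 1 -> ~~ is_free (mark_of pattern (pu i)).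
Proof.
have := slot_le3 i; case si: (slot i) => [|[|[|[|]]]] //= _ _.
- by apply: mark_of_edge (pattern_inner si) _; rewrite set21.
- have [||j iE sj] := @slot_pred i 2; rewrite ?si //.
  rewrite si in sj.
  by apply: mark_of_edge (pattern_inner sj) _; rewrite -iE set22.
by apply: mark_of_edge (pattern_spoke si) _; rewrite set22.
Qed.

Lemma pattern_dominating : mixed_dominating (petersen n 2) pattern.
Proof.
apply: mixed_dominatingI.
- apply/subsetP => _ /imsetP[i _ ->]; rewrite inE /pattern_elt.
  by case: (slot i) => [|[|?]] //; rewrite ?inner_edge ?spoke_edge.
- move=> e /petersen_edgeP[] [i ->].
  (* From an even slot the next column has an odd slot, whose outer vertex is not free. *)
  + have [si|si] := boolP (odd (slot i)).
      by exists (pv i); rewrite ?set21 ?pattern_pv.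
    have si3 := slot_le3 i.
    have [s0|s2] : slot i = 0 \/ slot i = 2 by lia.
    * by exists (pv (ord_addmod i 1)); rewrite ?set22 ?pattern_pv ?slot_addmod ?s0.
    by exists (pv (ord_addmod i 1)); rewrite ?set22 ?pattern_pv ?slot_addmod ?s2.
  + have [si|si] := eqVneq (slot i) 1.
      by exists (pv i); rewrite ?set21 ?pattern_pv ?si.
    by exists (pu i); rewrite ?set22 ?pattern_pu.
  have [si|si] := eqVneq (slot i) 1.
    by exists (pu (ord_addmod i 2)); rewrite ?set22 ?pattern_pu ?slot_addmod ?si.
  by exists (pu i); rewrite ?set21 ?pattern_pu.
(* A free vertex is outer at slot 0 or 2, or inner at slot 1; each is adjacent to the outer vertex
   at slot 1 of its block. *)
case=> i.
- have [si|nsi] := boolP (odd (slot i)).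
    by have := pattern_pv si => /negP.
  have si3 := slot_le3 i; move=> _.
  have [s0|s2] : slot i = 0 \/ slot i = 2 by lia.
    exists (pv (ord_addmod i 1)); last exact: outer_edge.
    by rewrite mark_of_dom pattern_vertex // slot_addmod ?s0.
  have [||j iE sj] := @slot_pred i 1; rewrite ?s2 //.
  exists (pv j); first by rewrite mark_of_dom pattern_vertex // sj s2.
  by rewrite setUC iE outer_edge.
have [si|si] := eqVneq (slot i) 1; last by have := pattern_pu si => /negP.
exists (pv i); first by rewrite mark_of_dom pattern_vertex.
by rewrite setUC spoke_edge.
Qed.

Lemma pattern_card : #|pattern| <= n - n %/ 4.
Proof.
apply: leq_trans (leq_imset_card _ _) _.
have := cardsC [set i : 'I_n | slot i != 2]; rewrite card_ord.
suff : n %/ 4 <= #|~: [set i : 'I_n | slot i != 2]| by lia.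
(* Column [4 * j + 2] is the one at slot 2 in block [j], which contributes nothing. *)
have inj_lt (j : 'I_(n %/ 4)) : 4 * j + 2 < n by have := ltn_ord j; lia.
pose f j := Ordinal (inj_lt j).
have f_inj : injective f by move=> j k /(congr1 val) /= jk; apply: val_inj => /=; lia.
rewrite -[X in X <= _]card_ord -(card_codom f_inj); apply: subset_leq_card.
apply/subsetP => _ /codomP[j ->]; rewrite !inE negbK /slot /=.
have := ltn_ord j; case: ifP; lia.
Qed.

End UpperBound.

Theorem theorem2 (n : nat) (hn : 4 <= n) :
  gamma_md (petersen n 2) =
    let m := n %/ 4 in
    match n %% 4 with
    | 0 => 3 * m
    | 1 => 3 * m + 1
    | 2 => 3 * m + 2
    | _ => 3 * m + 3
    end.
Proof.
have [[S domS cardS] minS] := gamma_mdP (petersen n 2).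
have lower := petersen_mixed_dominating_card hn domS.
have upper := leq_trans (minS _ (pattern_dominating hn)) (pattern_card hn).
(* The bounds [3 * n <= 4 * #|S|] and [#|S| <= n - n %/ 4] pin down one integer for each
   remainder. *)
move: (divn_eq n 4) (ltn_pmod n (isT : 0 < 4)) => nE /=.
by case: (n %% 4) nE => [|[|[|[|]]]] // ? _; lia.
Qed.
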